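(* Let $\tau>0$ be arbitrary, and let $(\bm u^n)$ with stages $\bm u_{n,i}$ ($i=0,\dots,s$) be produced by an $s$-stage, $p$th-order stabilized exponential-free Runge--Kutta method EFRK$(s,p)$ with time step $\tau$ and $\bm u^0\in\mathcal M_N^0$, as defined in the context. Let $\beta=\max_{n,i}\|\bm u_{n,i}\|_{\ell^\infty}$ (assumed finite) and assume that $$\kappa\ge\max_{|\xi|\le\beta}\tfrac12|f'(\xi)|.$$ Suppose that the following energy stability matrices (operators on $\mathcal M_N^0$) are all positive semi-definite: $$\Delta_{i,j},\quad 1\le j<i\le s,\qquad\text{and}\qquad \Delta_{i,i}-\frac12\sum_{j=1}^{i-1}\Delta_{i,j}-\frac12\sum_{j=i+1}^{s}\Delta_{j,i},\quad i=1,\dots,s.$$ Then the EFRK$(s,p)$ method is energy stable, with no restriction on the time step $\tau>0$: $$E(\bm u^{n+1})\le E(\bm u^n)\qquad\text{for all } n\ge0.$$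
   Context: Spatial discretization. Let $d\in\{1,2,3\}$, $\Omega=\prod_{k=1}^d(a_k,b_k)$, let $N_k$ be positive even integers, $h_k=(b_k-a_k)/N_k$, $\mu_k=2\pi/(b_k-a_k)$, $N=\prod_k N_k$. $\mathcal M_N\cong\mathbb R^N$ is the space of real periodic grid functions on the uniform grid with $N_k$ points in direction $k$, with $\langle \bm u,\bm v\rangle=(\prod_k h_k)\sum_i u_iv_i$ and $\|\bm u\|_{\ell^\infty}=\max_i|u_i|$; $\mathcal M_N^0=\{\bm v\in\mathcal M_N:\langle\bm v,\bm 1\rangle=0\}$, $\bm 1=[1,\dots,1]^T$. Let $F_{N_k}$ be the discrete Fourier transform matrix with entries $\frac1{N_k}e^{-2\pi \mathrm i lj/N_k}$ and $\Lambda_k=\mathrm{diag}(\lambda_{k,0},\dots,\lambda_{k,N_k-1})$ with $\lambda_{k,l}=-(\mu_k l)^2$ for $0\le l\le N_k/2$ and $\lambda_{k,l}=-(\mu_k(l-N_k))^2$ for $N_k/2<l\le N_k-1$. The discrete Laplacian $\Delta_N$ is the sum over $k=1,\dots,d$ of the operators $F_{N_k}^{-1}\Lambda_kF_{N_k}$ acting in the $k$-th grid direction (identity in the others). It is self-adjoint and negative semi-definite on $\mathcal M_N$, and negative definite on $\mathcal M_N^0$. Semi-discrete Cahn--Hilliard system. $\bm u_t=\Delta_N(-\epsilon^2\Delta_N\bm u+f(\bm u))$ on $\mathcal M_N^0$, $\epsilon>0$, $F(u)=\frac14(u^2-1)^2$, $f(u)=F'(u)=u^3-u$ (applied componentwise).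 With a stabilization parameter $\kappa\ge0$ it is written $\bm u_t=L_\kappa\bm u+N_\kappa(\bm u)$, $L_\kappa=\Delta_N(-\epsilon^2\Delta_N+\kappa I)$, $N_\kappa(\bm u)=\Delta_N f(\bm u)-\kappa\Delta_N\bm u$. Discrete energy: $E(\bm u)=-\frac{\epsilon^2}2\langle\bm u,\Delta_N\bm u\rangle+\langle F(\bm u),\bm 1\rangle$. EFRK method. Let $\phi_k(z)=\sum_{m=0}^k z^m/m!$. Let $a_{i,j}$ ($1\le i\le s$, $0\le j\le i-1$) be real coefficients of an $s$-stage explicit Runge--Kutta method of classical order $p$ (the last row $a_{s,j}$ being the weights), $c_0=0$, $c_i=\sum_{j=0}^{i-1}a_{i,j}$, $c_s=1$, satisfying the equilibrium-preserving conditions, i.e. the polynomial identities $\phi_i(c_iz)=1+z\sum_{j=0}^{i-1}a_{i,j}\phi_j(c_jz)$ for $i=1,\dots,s$. The EFRK$(s,p)$ method is $\bm u_{n,0}=\bm u^n$, $$\bm u_{n,i}=\big(\phi_i(-c_i\tau L_\kappa)\big)^{-1}\Big(\bm u^n+\tau\sum_{j=0}^{i-1}a_{i,j}\,\phi_j(-c_j\tau L_\kappa)N_\kappa(\bm u_{n,j})\Big),\quad i=1,\dots,s,$$ and $\bm u^{n+1}=\bm u_{n,s}$ (all iterates and stages lie in $\mathcal M_N^0$). It is assumed that the matrices $\phi_i(-c_i\tau L_\kappa)$ are invertible (automatic when $c_i\ge0$) and that $a_{i,i-1}\ne0$ for $i=1,\dots,s$. The matrices $\Delta_{i,j}$. Abbreviate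 $\phi_i=\phi_i(-c_i\tau L_\kappa)$. Solving each stage equation successively for $N_\kappa(\bm u_{n,i-1})$ expresses $L_\kappa\bm u_{n,i}+N_\kappa(\bm u_{n,i-1})=\tau^{-1}\sum_{k=0}^i\omega_{i,k}\bm u_{n,k}$, with $\omega_{i,k}$ given recursively for $i=1,\dots,s$, $0\le k\le i$ by $$\omega_{i,k}=\delta_{k,i}\,\tau L_\kappa+(a_{i,i-1}\phi_{i-1})^{-1}\Big(\delta_{k,i}\phi_i-\delta_{k,0}I-\sum_{j=0}^{i-2}a_{i,j}\phi_j\big(\omega_{j+1,k}-\delta_{k,j+1}\tau L_\kappa\big)\Big),$$ with $\omega_{j+1,k}=0$ for $k>j+1$ ($\delta$ the Kronecker delta). Then $\Delta_{i,j}=\sum_{k=j}^i\omega_{i,k}$ for $1\le j\le i\le s$ (not to be confused with the Laplacian $\Delta_N$). *)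

(* Defs.v *)
From mathcomp Require Import all_boot all_order all_algebra.
From mathcomp Require Import all_classical all_reals all_analysis.
From mathcomp Require Import complex.

Set Implicit Arguments.
Unset Strict Implicit.
Unset Printing Implicit Defensive.

Import Order.TTheory GRing.Theory Num.Theory numFieldNormedType.Exports.
Local Open Scope classical_set_scope.
Local Open Scope ring_scope.

Definition gridpt (d : nat) (n : 'I_d -> nat) : finType :=
  {dffun forall k : 'I_d, 'I_(n k)}.

(* The entry of a grid function at the grid point x is [u (enum_rank x) 0]. *)
Definition gridfun (R : realType) (d : nat) (n : 'I_d -> nat) :=
  'cV[R]_#|gridpt n|.

Definition inner (R : realType) (d : nat) (lo hi : 'I_d -> R)
    (n : 'I_d -> nat) (u v : gridfun R n) : R :=
  (\prod_k ((hi k - lo k) / (n k)%:R)) * \sum_x u x 0 * v x 0.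

Definition meanzero (R : realType) (d : nat) (lo hi : 'I_d -> R)
    (n : 'I_d -> nat) (v : gridfun R n) : Prop :=
  inner lo hi v (const_mx 1) = 0.

Definition expi (R : realType) (t : R) : R[i] := Complex (cos t) (sin t).

Definition dft (R : realType) (m : nat) : 'M[R[i]]_m :=
  \matrix_(l < m, j < m)
    (m%:R^-1 * expi (- (2 * pi * l%:R * j%:R / m%:R) : R)).

Definition fourier_symbol (R : realType) (len : R) (m : nat) (l : nat) : R :=
  let mu := 2 * pi / len in
  if (l <= m./2)%N then - (mu * l%:R) ^+ 2 else - (mu * (l%:R - m%:R)) ^+ 2.

(* The complex matrix F^-1 Lambda F has real entries, because the symbol is
   invariant under l |-> m - l; taking real parts only changes its type. *)
Definition laplacian1 (R : realType) (len : R) (m : nat) : 'M[R]_m :=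
  map_mx (@complex.Re R)
    (invmx (dft R m)
     *m diag_mx (\row_(l < m) real_complex R (fourier_symbol len m l))
     *m dft R m).

(* The k-th summand acts as [laplacian1] on the k-th coordinate and as the
   identity on the others. *)
Definition laplacian (R : realType) (d : nat) (lo hi : 'I_d -> R)
    (n : 'I_d -> nat) : 'M[R]_#|gridpt n| :=
  \matrix_(x, y)
    let X : gridpt n := enum_val x in
    let Y : gridpt n := enum_val y in
    \sum_k (if [forall l, (l != k) ==> (X l == Y l)]
            then laplacian1 (hi k - lo k) (n k) (X k) (Y k) else 0).

(* Self-adjointness is not part of the definition: it is automatic for the
   energy stability matrices, which are rational functions of [laplacian]. *)
Definition psd_meanzero (R : realType) (d : nat) (lo hi : 'I_d -> R)
    (n : 'I_d -> nat) (M : 'M[R]_#|gridpt n|) : Prop :=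
  forall v : gridfun R n, meanzero lo hi v -> 0 <= inner lo hi v (M *m v).

Definition potential (R : realType) (x : R) : R := 4^-1 * (x ^+ 2 - 1) ^+ 2.

Definition nonlin (R : realType) (x : R) : R := x ^+ 3 - x.

Definition stiff (R : realType) (d : nat) (lo hi : 'I_d -> R)
    (n : 'I_d -> nat) (eps kappa : R) : 'M[R]_#|gridpt n| :=
  let D := laplacian lo hi n in D *m (- eps ^+ 2 *: D + kappa%:M).

Definition nonstiff (R : realType) (d : nat) (lo hi : 'I_d -> R)
    (n : 'I_d -> nat) (kappa : R) (u : gridfun R n) : gridfun R n :=
  let D := laplacian lo hi n in
  D *m map_mx (@nonlin R) u - kappa *: (D *m u).

Definition energy (R : realType) (d : nat) (lo hi : 'I_d -> R)
    (n : 'I_d -> nat) (eps : R) (u : gridfun R n) : R :=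
  - (eps ^+ 2 / 2) * inner lo hi u (laplacian lo hi n *m u)
  + inner lo hi (map_mx (@potential R) u) (const_mx 1).

(* Throughout, only the values [a i j] with 1 <= i <= s and 0 <= j < i matter;
   the row [a s] holds the weights. *)
Definition absc (R : realType) (a : nat -> nat -> R) (i : nat) : R :=
  \sum_(j < i) a i j.

(* C^k regularity through iterated directional derivatives. *)
Fixpoint Cdiff (R : realType) (V W : normedModType R) (k : nat) (g : V -> W)
    : Prop :=
  match k with
  | 0 => continuous g
  | k'.+1 => [/\ continuous g, forall v x, derivable g x v
                & forall v, Cdiff k' (fun x => 'D_v g x)]
  end.

(* Classical order p: for every smooth autonomous system y' = g(y), one step
   started on a solution has local error O(h^(p+1)) as h -> 0+.
   [Y h 0, ..., Y h s] are the stages of the step of size h, [Y h s] being its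
   result. As usual, "order p" means order at least p. *)
Definition rk_order (R : realType) (s p : nat) (a : nat -> nat -> R) : Prop :=
  forall (m : nat) (g : 'rV[R]_m -> 'rV[R]_m) (y : R -> 'rV[R]_m)
         (Y : R -> nat -> 'rV[R]_m),
    (forall k, Cdiff k g) ->
    (\forall t \near (0 : R), is_derive t (1 : R) y (g (y t))) ->
    (forall h i, (i <= s)%N ->
       Y h i = y 0 + h *: \sum_(j < i) a i j *: g (Y h j)) ->
    exists C : R, \forall h \near 0^'+, `|y h - Y h s| <= C * h ^+ p.+1.

Definition phi (R : realType) (k : nat) : {poly R} :=
  \poly_(m < k.+1) (m`!%:R)^-1.

Definition equilibrium_preserving (R : realType) (s : nat)
    (a : nat -> nat -> R) : Prop :=
  forall i, (1 <= i <= s)%N ->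
    phi R i \Po (absc a i *: 'X)
    = 1 + 'X * \sum_(j < i) a i j *: (phi R j \Po (absc a j *: 'X)).

Definition efrk_coeffs (R : realType) (s p : nat) (a : nat -> nat -> R)
    : Prop :=
  [/\ rk_order s p a, absc a s = 1 & equilibrium_preserving s a].

(* [horner_mx] is restricted to sizes of the form m.+1. *)
Definition poly_mx (R : realType) (m : nat) (q : {poly R}) (A : 'M[R]_m)
    : 'M[R]_m :=
  \sum_(k < size q) q`_k *: A ^+ k.

Definition phimx (R : realType) (m : nat) (a : nat -> nat -> R) (tau : R)
    (L : 'M[R]_m) (i : nat) : 'M[R]_m :=
  poly_mx (phi R i) (- (absc a i * tau) *: L).

(* [u t] is the t-th iterate and [U t i] the i-th stage of the step from [u t]
   to [u t.+1]. *)
Definition efrk_trajectory (R : realType) (d : nat) (lo hi : 'I_d -> R)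
    (n : 'I_d -> nat) (eps kappa tau : R) (s : nat) (a : nat -> nat -> R)
    (u : nat -> gridfun R n) (U : nat -> nat -> gridfun R n) : Prop :=
  let P := phimx a tau (stiff lo hi n eps kappa) in
  forall t, [/\ U t 0%N = u t,
    forall i, (1 <= i <= s)%N ->
      U t i = invmx (P i) *m
        (u t + tau *: \sum_(j < i)
                        a i j *: (P j *m nonstiff lo hi kappa (U t j)))
    & u t.+1 = U t s].

(* [omega_row a tau L w i] computes omega_(i,.) from the previous rows
   w = [:: omega_(1,.); ...; omega_(i-1,.)]. *)
Definition omega_row (R : realType) (m : nat) (a : nat -> nat -> R) (tau : R)
    (L : 'M[R]_m) (w : seq (nat -> 'M[R]_m)) (i k : nat) : 'M[R]_m :=
  let P := phimx a tau L in
  (k == i)%:R *: (tau *: L)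
  + invmx (a i i.-1 *: P i.-1) *m
    ((k == i)%:R *: P i - (k == 0%N)%:R *: 1%:M
     - \sum_(j < i.-1)
         a i j *: (P j *m (nth (fun=> 0) w j k
                           - (k == j.+1)%:R *: (tau *: L)))).

Fixpoint omega_rows (R : realType) (m : nat) (a : nat -> nat -> R) (tau : R)
    (L : 'M[R]_m) (i : nat) : seq (nat -> 'M[R]_m) :=
  if i is i'.+1 then
    let w := omega_rows a tau L i' in rcons w (omega_row a tau L w i)
  else [::].

Definition omega (R : realType) (m : nat) (a : nat -> nat -> R) (tau : R)
    (L : 'M[R]_m) (i k : nat) : 'M[R]_m :=
  nth (fun=> 0) (omega_rows a tau L i) i.-1 k.

Definition Delta (R : realType) (m : nat) (a : nat -> nat -> R) (tau : R)
    (L : 'M[R]_m) (i j : nat) : 'M[R]_m :=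
  \sum_(j <= k < i.+1) omega a tau L i k.

Lemma size_omega_rows (R : realType) (m : nat) (a : nat -> nat -> R) (tau : R)
  (L : 'M[R]_m) i : size (omega_rows a tau L i) = i.
Proof. by elim: i => //= i IHi; rewrite size_rcons IHi. Qed.

Lemma nth_omega_rows (R : realType) (m : nat) (a : nat -> nat -> R) (tau : R)
  (L : 'M[R]_m) i j k : (j < i)%N ->
  nth (fun=> 0) (omega_rows a tau L i) j k = omega a tau L j.+1 k.
Proof.
elim: i => // i IHi; rewrite ltnS leq_eqVlt => /predU1P[->//|ltji].
by rewrite /= nth_rcons size_omega_rows ltji IHi.
Qed.

Lemma omegaE (R : realType) (m : nat) (a : nat -> nat -> R) (tau : R)
  (L : 'M[R]_m) i k : (1 <= i)%N ->
  let P := phimx a tau L in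
  omega a tau L i k =
    (k == i)%:R *: (tau *: L)
    + invmx (a i i.-1 *: P i.-1) *m
      ((k == i)%:R *: P i - (k == 0%N)%:R *: 1%:M
       - \sum_(j < i.-1)
           a i j *: (P j *m (omega a tau L j.+1 k
                             - (k == j.+1)%:R *: (tau *: L)))).
Proof.
case: i => // i _ P; rewrite {1}/omega /= nth_rcons size_omega_rows ltnn eqxx.
rewrite /omega_row /=; congr (_ + _ *m (_ - _)).
by apply: eq_bigr => j _; rewrite nth_omega_rows.
Qed.

Lemma omega_eq0 (R : realType) (m : nat) (a : nat -> nat -> R) (tau : R)
  (L : 'M[R]_m) i k : (i < k)%N -> omega a tau L i k = 0.
Proof.
elim/ltn_ind: i => -[|i] IHi ltik; first by rewrite /omega.
rewrite omegaE //= (gtn_eqF ltik) (gtn_eqF (leq_ltn_trans (leq0n _) ltik)).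
rewrite !scale0r !subr0 add0r sub0r big1 ?oppr0 ?mulmx0 // => j _.
have ltj : (j.+1 < i.+1)%N by rewrite ltnS ltn_ord.
have ltjk := ltn_trans ltj ltik; rewrite (IHi _ ltj ltjk) (gtn_eqF ltjk).
by rewrite scale0r subr0 mulmx0 scaler0.
Qed.

(* Main.v *)
Require Import Defs.
From mathcomp Require Import all_boot all_order all_algebra.
From mathcomp Require Import all_classical all_reals all_analysis.
From mathcomp Require Import complex zify ring lra.

Import Order.TTheory GRing.Theory Num.Theory numFieldNormedType.Exports.
Local Open Scope classical_set_scope.
Local Open Scope ring_scope.

(* Write w_i = u_{n,i} - u_{n,i-1}.  Convexity of the quadratic part and the
   lower bound on kappa give E(u_{n,i}) - E(u_{n,i-1}) <= <w_i, g_i>, where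
   Delta_N g_i = L u_{n,i} + N(u_{n,i-1}).  Since sum_k omega_{i,k} = 0 (this
   is the equilibrium-preserving condition), summation by parts turns this
   vector into tau^-1 sum_j Delta_{i,j} w_j.  The stages have equal mass, so
   w_i = Delta_N q_i, and <w_i, g_i> = - tau^-1 sum_j B_{i,j}(q_i, q_j) with
   B_{i,j}(p, q) = - <p, Delta_{i,j} Delta_N q>.  If M is symmetric, positive
   semi-definite on mean-zero vectors and a rational function of Delta_N,
   write - Delta_N = sum_k G_k^2, with G_k the square root of the k-th
   directional part: then - <p, M Delta_N q> = sum_k <G_k p, M G_k q> is a
   positive semi-definite form.  Hence 2 B(p, q) >= - B(p, p) - B(q, q), and
   the off-diagonal terms are absorbed by the diagonal stability matrices. *)

(** * Real Fourier multipliers *)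

Section DiscreteFourier.
Variable R : realType.
Implicit Types (t : R) (m : nat) (sigma rho : nat -> R).

Lemma expiD (t1 t2 : R) : expi (t1 + t2) = expi t1 * expi t2.
Proof.
by apply/eqP; rewrite eq_complex /= cosD sinD; apply/andP; split;
  apply/eqP; ring.
Qed.

Lemma expi0 : expi (0 : R) = 1.
Proof. by rewrite /expi cos0 sin0. Qed.

Lemma expiMn t k : expi (t *+ k) = expi t ^+ k.
Proof.
elim: k => [|k IHk]; first by rewrite mulr0n expi0.
by rewrite mulrS expiD IHk exprS.
Qed.

Lemma expi_neq0 t : expi t != 0.
Proof.
have : expi t * expi (- t) = 1 by rewrite -expiD subrr expi0.
by apply: contraPneq => ->; rewrite mul0r => /esym/eqP; rewrite oner_eq0.
Qed.

Lemma expiN t : expi (- t) = (expi t)^-1.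
Proof.
by apply: (mulfI (expi_neq0 t)); rewrite -expiD subrr expi0 mulfV ?expi_neq0.
Qed.

Definition omega_dft m : R[i] := expi (2 * pi / m%:R : R).

(** The order k of this root divides m. If k < m, then cos (2 pi k / m) = 1 forces sin (pi k / m) =
    0 by the double-angle formula, although 0 < pi k / m < pi. *)
Lemma omega_dft_prim m : (0 < m)%N -> m.-primitive_root (omega_dft m).
Proof.
move=> m0; have mR : (0 : R) < m%:R by rewrite ltr0n.
have zm : omega_dft m ^+ m = 1.
  rewrite /omega_dft -expiMn -[X in expi X]mulr_natr divfK ?gt_eqF//.
  by rewrite mulr_natl /expi cos2pi sin2pi.
have [k pk kdvd] := prim_order_exists m0 zm.
have k0 := prim_order_gt0 pk.
move: kdvd; rewrite dvdn_eq => /eqP mk.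
have [e|kneqm] := eqVneq k m; first by rewrite -{1}e.
have km : (k < m)%N.
  rewrite ltn_neqAle kneqm /=; move: m0; rewrite -{1 2}mk.
  by rewrite muln_gt0 => /andP[q0 _]; rewrite leq_pmull.
have := prim_expr_order pk; rewrite /omega_dft -expiMn.
rewrite -[X in expi X]mulr_natr => /eqP.
have -> : (2 * pi / m%:R * k%:R : R) = (pi * k%:R / m%:R) *+ 2.
  by rewrite -mulr_natr; field; rewrite gt_eqF.
rewrite eq_complex /= cos_mulr2n => /andP[/eqP c1 _].
have : 0 < sin (pi * k%:R / m%:R : R).
  apply: sin_gt0_pi; rewrite divr_gt0 ?mulr_gt0 ?pi_gt0 ?ltr0n//=.
  by rewrite ltr_pdivrMr// ltr_pM2l ?pi_gt0// ltr_nat.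
by have := cos2Dsin2 (pi * k%:R / m%:R : R); nra.
Qed.

Definition idft m : 'M[R[i]]_m := \matrix_(j, l) omega_dft m ^+ (l * j).

Lemma dftE m (l j : 'I_m) : dft R m l j = m%:R^-1 * omega_dft m ^- (l * j).
Proof.
rewrite mxE expiN; congr (_ * _^-1).
rewrite -expiMn -[X in _ = expi X]mulr_natr natrM.
by congr expi; ring.
Qed.

(** Each entry is a geometric sum in an m-th root of unity x; for x different from 1 it vanishes
    because (x - 1) times the sum is x^m - 1 = 0. *)
Lemma mul_dft_idft m : (0 < m)%N -> dft R m *m idft m = 1%:M.
Proof.
move=> m0; have pz := omega_dft_prim m m0.
have z0 : omega_dft m != 0 := expi_neq0 _.
have mC : (m%:R : R[i]) != 0 by rewrite pnatr_eq0 -lt0n.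
apply/matrixP => l k; rewrite !mxE.
pose x := omega_dft m ^+ k / omega_dft m ^+ l.
have -> : \sum_j dft R m l j * idft m j k = m%:R^-1 * \sum_(j < m) x ^+ j.
  rewrite mulr_sumr; apply: eq_bigr => j _; rewrite dftE mxE -mulrA.
  by rewrite /x expr_div_n -!exprM [X in _ * X = _]mulrC.
have [lk|lk] := eqVneq l k.
  rewrite (eq_bigr (fun=> 1)) => [|j _]; last first.
    by rewrite /x -lk divff ?expr1n// expf_neq0.
  by rewrite sumr_const card_ord mulVf.
have x1 : x - 1 != 0.
  rewrite subr_eq0 /x; apply: contra lk => /eqP xe.
  have /eqP : omega_dft m ^+ k = omega_dft m ^+ l.
    by rewrite -[RHS]mul1r -xe divfK// expf_neq0.
  by rewrite (eq_prim_root_expr pz) !modn_small ?ltn_ord// eq_sym.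
rewrite [X in _ * X](_ : _ = 0) ?mulr0//; apply: (mulfI x1).
rewrite -subrX1 mulr0 /x expr_div_n -!exprM ![(_ * m)%N]mulnC !exprM.
by rewrite (prim_expr_order pz) !expr1n divr1 subrr.
Qed.

Lemma invmx_dft m : (0 < m)%N -> invmx (dft R m) = idft m.
Proof.
move=> m0; have e := mul_dft_idft m m0; have [u _] := mulmx1_unit e.
by rewrite -[LHS]mulmx1 -e mulmxA mulVmx// mul1mx.
Qed.

(** Convertible to [laplacian1] when the symbol is [fourier_symbol]. Its algebra is done on the
    complex matrix [fourier_cmult] and pulled back along the injection of the reals. *)
Definition fourier_mult m sigma : 'M[R]_m :=
  map_mx (@complex.Re R)
    (invmx (dft R m) *m diag_mx (\row_(l < m) real_complex R (sigma l))
     *m dft R m).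

Definition fourier_cmult m sigma : 'M[R[i]]_m :=
  idft m *m diag_mx (\row_(l < m) real_complex R (sigma l)) *m dft R m.

(* The Fourier multiplier of [sigma] is a real matrix exactly when [sigma] is
   invariant under l |-> m - l. *)
Definition reflecting m sigma :=
  forall l, (0 < l < m)%N -> sigma (m - l)%N = sigma l.

Lemma fourier_cmultE m sigma (j k : 'I_m) :
  fourier_cmult m sigma j k =
  \sum_(l < m) real_complex R (sigma l) / m%:R
     * (omega_dft m ^+ (l * j) / omega_dft m ^+ (l * k)).
Proof.
rewrite /fourier_cmult mxE; apply: eq_bigr => l _.
by rewrite mul_mx_diag dftE !mxE; ring.
Qed.

(** Replacing l by -l in Z/m inverts the powers of the root, which exchanges the two indices of the
    entry. *)
Lemma fourier_cmult_sym m sigma (j k : 'I_m) : reflecting m sigma ->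
  fourier_cmult m sigma k j = fourier_cmult m sigma j k.
Proof.
case: m j k => [[]//|m] j k rs; have pz := omega_dft_prim m.+1 isT.
have z0 : omega_dft m.+1 != 0 := expi_neq0 _.
rewrite !fourier_cmultE.
rewrite (reindex_inj (@oppr_inj 'I_m.+1)) /=; apply: eq_bigr => l _.
(* The index 0 is its own opposite modulo m, and [reflecting] says nothing about it. *)
have [->|l0] := eqVneq l 0; first by rewrite subn0 modnn !mul0n expr0.
have lgt0 : (0 < l)%N by rewrite lt0n.
have -> : ((m.+1 - l) %% m.+1)%N = (m.+1 - l)%N.
  by rewrite modn_small// ltn_subrL lgt0.
rewrite rs ?lgt0 ?ltn_ord//; congr (_ * _).
have expz (i : 'I_m.+1) :
    omega_dft m.+1 ^+ ((m.+1 - l) * i) = (omega_dft m.+1 ^+ (l * i))^-1.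
  apply: (@mulfI _ (omega_dft m.+1 ^+ (l * i))); first exact: expf_neq0.
  rewrite mulfV ?expf_neq0// -exprD -mulnDl subnKC 1?ltnW ?ltn_ord//.
  by rewrite exprM (prim_expr_order pz) expr1n.
by rewrite !expz invrK mulrC.
Qed.

Let conjcM (x y : R[i]) : conjc (x * y) = conjc x * conjc y := rmorphM _ x y.
Let conjcX (x : R[i]) k : conjc (x ^+ k) = conjc x ^+ k := rmorphXn _ k x.

Lemma conj_omega_dft m : conjc (omega_dft m) = (omega_dft m)^-1.
Proof. by rewrite -expiN /omega_dft /expi cosN sinN. Qed.

(** Conjugation inverts the root, hence exchanges the two indices; by symmetry every entry equals
    its own conjugate. *)
Lemma map_fourier_mult m sigma : (0 < m)%N -> reflecting m sigma ->
  map_mx (real_complex R) (fourier_mult m sigma) = fourier_cmult m sigma.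
Proof.
move=> m0 rs; apply/matrixP => j k; rewrite /fourier_mult invmx_dft// 2!mxE.
rewrite -/(fourier_cmult m sigma).
have : conjc (fourier_cmult m sigma j k) = fourier_cmult m sigma j k.
  rewrite -[RHS](fourier_cmult_sym m sigma _ _ rs) !fourier_cmultE rmorph_sum.
  apply: eq_bigr => l _ /=; rewrite !conjcM conjc_real !conjc_inv conjc_nat.
  by rewrite !conjcX conj_omega_dft !exprVn invrK [X in _ * X]mulrC.
case: (fourier_cmult m sigma j k) => x y /eqP; rewrite eq_complex /= eqxx /=.
by rewrite eq_sym -subr_eq0 opprK -mulr2n mulrn_eq0 /= => /eqP ->.
Qed.

Lemma map_real_complex_inj p q : injective (@map_mx _ _ (real_complex R) p q).
Proof.
move=> A B /matrixP AB; apply/matrixP => i j.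
by have := AB i j; rewrite !mxE => -[].
Qed.

Lemma fourier_mult_sym m sigma : (0 < m)%N -> reflecting m sigma ->
  (fourier_mult m sigma)^T = fourier_mult m sigma.
Proof.
move=> m0 rs; apply: map_real_complex_inj; rewrite map_fourier_mult//.
apply/matrixP => j k; rewrite 2!mxE -fourier_cmult_sym//.
by rewrite -(map_fourier_mult _ _ m0 rs) [RHS]mxE.
Qed.

Lemma fourier_multM m sigma rho : (0 < m)%N ->
  reflecting m sigma -> reflecting m rho ->
  fourier_mult m sigma *m fourier_mult m rho
  = fourier_mult m (fun l => sigma l * rho l).
Proof.
move=> m0 rs rr; have rsr : reflecting m (fun l => sigma l * rho l).
  by move=> l lm; rewrite rs ?rr.
apply: map_real_complex_inj; rewrite (map_fourier_mult _ _ m0 rsr) map_mxM.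
transitivity (fourier_cmult m sigma *m fourier_cmult m rho).
  by congr (_ *m _); exact: map_fourier_mult.
rewrite /fourier_cmult -!mulmxA (mulmxA (dft R m) (idft m)).
rewrite (mul_dft_idft _ m0) mul1mx.
rewrite (mulmxA (diag_mx _) (diag_mx _)) mulmx_diag.
by congr (_ *m (diag_mx _ *m _)); apply/rowP => l; rewrite !mxE rmorphM.
Qed.

Lemma fourier_multN m sigma : (0 < m)%N -> reflecting m sigma ->
  fourier_mult m (fun l => - sigma l) = - fourier_mult m sigma.
Proof.
move=> m0 rs; have rN : reflecting m (fun l => - sigma l).
  by move=> l lm; rewrite rs.
apply: map_real_complex_inj; rewrite map_mxN.
transitivity (fourier_cmult m (fun l => - sigma l)).
  exact: map_fourier_mult.
transitivity (- fourier_cmult m sigma); last first.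
  by congr (- _); apply/esym; exact: map_fourier_mult.
rewrite /fourier_cmult -mulNmx -mulmxN; congr (_ *m _ *m _).
by apply/matrixP => i j; rewrite !mxE rmorphN mulNrn.
Qed.

Lemma dft_const1 m : (0 < m)%N ->
  dft R m *m const_mx 1 = \col_l (val l == 0%N)%:R.
Proof.
move=> m0; have /matrixP e := mul_dft_idft m m0; apply/colP => l.
rewrite !mxE; have := e l (Ordinal m0); rewrite !mxE => <-.
by apply: eq_bigr => j _; rewrite !mxE mul0n expr0.
Qed.

Lemma fourier_mult_const1 m sigma : (0 < m)%N -> reflecting m sigma ->
  sigma 0%N = 0 -> fourier_mult m sigma *m const_mx 1 = 0 :> 'cV_m.
Proof.
move=> m0 rs s0; apply: map_real_complex_inj.
rewrite map_mxM map_fourier_mult// map_const_mx rmorph1 map_mx0.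
rewrite /fourier_cmult -!mulmxA dft_const1// [X in _ *m X](_ : _ = 0) ?mulmx0//.
apply/colP => l; rewrite mul_diag_mx !mxE.
by case: eqP => [->|]; rewrite ?s0 ?mulr0 ?mul0r.
Qed.

(** In Fourier space the equation is diagonal, so all modes l > 0 of [v] vanish and only the
    constant mode is left. *)
Lemma fourier_mult_ker m sigma (v : 'cV[R]_m) (i j : 'I_m) :
  (0 < m)%N -> reflecting m sigma ->
  (forall l, (0 < l < m)%N -> sigma l != 0) ->
  fourier_mult m sigma *m v = 0 -> v i 0 = v j 0.
Proof.
move=> m0 rs s0 /(congr1 (map_mx (real_complex R))).
rewrite map_mxM map_fourier_mult// map_mx0; set w := map_mx _ v.
move=> /(congr1 (mulmx (dft R m))).
rewrite mulmx0 /fourier_cmult !mulmxA mul_dft_idft// mul1mx -mulmxA.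
move=> /matrixP dw; have dw0 (l : 'I_m) : (0 < l)%N -> (dft R m *m w) l 0 = 0.
  move=> l0; have := dw l 0; rewrite mul_diag_mx mxE !mxE => /eqP.
  rewrite mulf_eq0 => /orP[|/eqP//]; rewrite eq_complex /= eqxx andbT.
  by rewrite (negbTE (s0 _ _))// l0 ltn_ord.
have we : w = idft m *m (dft R m *m w).
  by rewrite mulmxA (mulmx1C (mul_dft_idft m m0)) mul1mx.
have wE k : w k 0 = (dft R m *m w) (Ordinal m0) 0.
  rewrite {1}we mxE (bigD1 (Ordinal m0))//= big1 => [|l l0].
    by rewrite addr0 !mxE mul0n expr0 mul1r.
  by rewrite dw0 ?mulr0// lt0n.
have : w i 0 = w j 0 by rewrite !wE.
by rewrite !mxE => -[].
Qed.

End DiscreteFourier.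

(** * Operators acting in one grid direction *)

Section DirectionalOperators.
Variables (R : realType) (d : nat) (n : 'I_d -> nat).
Implicit Types (X Y : gridpt n) (k l : 'I_d).

Definition dirmx k (A : 'M[R]_(n k)) : 'M[R]_#|gridpt n| :=
  \matrix_(x, y)
    let X : gridpt n := enum_val x in
    let Y : gridpt n := enum_val y in
    if [forall l, (l != k) ==> (X l == Y l)] then A (X k) (Y k) else 0.

Lemma laplacianE (lo hi : 'I_d -> R) :
  laplacian lo hi n = \sum_k dirmx k (laplacian1 (hi k - lo k) (n k)).
Proof.
apply/matrixP => x y; rewrite mxE summxE.
by apply: eq_bigr => k _; rewrite [RHS]mxE.
Qed.

Definition upd X k (j : 'I_(n k)) : gridpt n := finfun (eqtype.dfwith X j).

Lemma upd_in X k (j : 'I_(n k)) : upd X k j k = j.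
Proof. by rewrite ffunE eqtype.dfwith_in. Qed.

Lemma upd_out X k (j : 'I_(n k)) l : k != l -> upd X k j l = X l.
Proof. by move=> kl; rewrite ffunE dfwith_out. Qed.

Lemma updP X Y k (j : 'I_(n k)) : Y k = j -> (forall l, k != l -> Y l = X l) ->
  Y = upd X k j.
Proof.
move=> Yk Yl; apply/ffunP => l.
by have [<-|kl] := eqVneq k l; rewrite ?upd_in// upd_out// Yl.
Qed.

Lemma upd_upd X k (i j : 'I_(n k)) : upd (upd X k i) k j = upd X k j.
Proof. by apply: updP => [|l kl]; rewrite ?upd_in// !upd_out. Qed.

Lemma updC X k l (i : 'I_(n k)) (j : 'I_(n l)) : k != l ->
  upd (upd X k i) l j = upd (upd X l j) k i.
Proof.
move=> kl; apply: updP => [|m km]; first by rewrite upd_out 1?eq_sym// upd_in.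
have [<-|lm] := eqVneq l m; first by rewrite !upd_in.
by rewrite !upd_out.
Qed.

(** Only the points that agree with [X] off direction [k] contribute, and their [k]-th coordinate
    parametrizes them. Products of directional operators thereby reduce to one-dimensional sums. *)
Lemma mul_dirmxE k (A : 'M[R]_(n k)) q (V : 'M[R]_(#|gridpt n|, q)) X c :
  (dirmx k A *m V) (enum_rank X) c
  = \sum_j A (X k) j * V (enum_rank (upd X k j)) c.
Proof.
rewrite mxE (reindex (enum_rank : gridpt n -> _)) /=; last first.
  by apply: onW_bij; exact: enum_rank_bij.
pose P := [pred Y : gridpt n | [forall l, (l != k) ==> (X l == Y l)]].
rewrite (bigID P) /= [X in _ + X]big1 ?addr0; last first.
  by move=> Y /negbTE PY; rewrite mxE /= !enum_rankK PY mul0r.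
rewrite (reindex_onto (upd X k) (fun Y : gridpt n => Y k)) /=; last first.
  move=> Y /forallP PY; apply/esym/updP => // l kl; apply/esym/eqP.
  by have := PY l; rewrite eq_sym kl.
apply: eq_big => [j|j /andP[PY _]].
  rewrite upd_in eqxx andbT; apply/forallP => l; apply/implyP => lk.
  by rewrite upd_out// eq_sym.
by rewrite mxE /= !enum_rankK PY upd_in.
Qed.

Lemma dirmx_rect q (V W : 'M[R]_(#|gridpt n|, q)) :
  (forall X c, V (enum_rank X) c = W (enum_rank X) c) -> V = W.
Proof. by move=> VW; apply/matrixP => x c; rewrite -(enum_valK x) VW. Qed.

Lemma dirmxM k (A B : 'M[R]_(n k)) : dirmx k A *m dirmx k B = dirmx k (A *m B).
Proof.
(* The identity factors give [mul_dirmxE] a matrix to act on. *)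
rewrite -[RHS]mulmx1 -[dirmx k B]mulmx1; apply: dirmx_rect => X c.
rewrite !mul_dirmxE; under eq_bigr do rewrite mul_dirmxE mulr_sumr.
rewrite exchange_big; apply: eq_bigr => j _ /=; rewrite mxE mulr_suml.
by apply: eq_bigr => i _; rewrite upd_in upd_upd mulrA.
Qed.

Lemma dirmxC k l (A : 'M[R]_(n k)) (B : 'M[R]_(n l)) : k != l ->
  dirmx k A *m dirmx l B = dirmx l B *m dirmx k A.
Proof.
move=> kl; have lk : l != k by rewrite eq_sym.
rewrite -[dirmx l B in LHS]mulmx1 -[dirmx k A in RHS]mulmx1.
apply: dirmx_rect => X c; rewrite !mul_dirmxE.
under eq_bigr do rewrite mul_dirmxE mulr_sumr.
under [RHS]eq_bigr do rewrite mul_dirmxE mulr_sumr.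
rewrite exchange_big; apply: eq_bigr => j _; apply: eq_bigr => i _ /=.
by rewrite mulrCA (updC _ _ _ _ _ kl) (upd_out _ _ _ _ kl) (upd_out _ _ _ _ lk).
Qed.

Lemma tr_dirmx k (A : 'M[R]_(n k)) : (dirmx k A)^T = dirmx k A^T.
Proof.
apply/matrixP => x y; rewrite !mxE.
congr (if _ then _ else _); last by rewrite mxE.
by apply: eq_forallb => l; rewrite [X in _ ==> X]eq_sym.
Qed.

Lemma dirmx_const1 k (A : 'M[R]_(n k)) :
  A *m const_mx 1 = 0 :> 'cV_(n k) -> dirmx k A *m const_mx 1 = 0 :> 'cV_ _.
Proof.
move=> A1; apply: dirmx_rect => X c; rewrite mul_dirmxE mxE.
have /matrixP/(_ (X k) 0) := A1; rewrite !mxE => A1k; rewrite -[RHS]A1k.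
by apply: eq_bigr => j _; rewrite !mxE.
Qed.

Lemma dirmxN k (A : 'M[R]_(n k)) : dirmx k (- A) = - dirmx k A.
Proof.
apply/matrixP => x y; rewrite !mxE /=.
by case: ifP => _; rewrite ?mxE ?oppr0.
Qed.

(** Each equation makes [v] constant along the grid lines of its direction, and changing one
    coordinate at a time joins any two grid points. *)
Lemma dirmx_ker (A : forall k, 'M[R]_(n k)) (v : 'cV[R]_#|gridpt n|) :
  (forall k (w : 'cV_(n k)) i j, A k *m w = 0 -> w i 0 = w j 0) ->
  (forall k, dirmx k (A k) *m v = 0) -> forall x y, v x 0 = v y 0.
Proof.
move=> kerA Av x y; pose f X := v (enum_rank X) 0.
have f_upd X k (j : 'I_(n k)) : f (upd X k j) = f X.
  pose w : 'cV[R]_(n k) := \col_i f (upd X k i).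
  have Aw : A k *m w = 0.
    apply/colP => i; rewrite !mxE.
    have /matrixP/(_ (enum_rank (upd X k i)) 0) := Av k.
    rewrite mul_dirmxE mxE => Avk; rewrite -[RHS]Avk.
    by apply: eq_bigr => l _; rewrite mxE upd_in upd_upd.
  have := kerA k w j (X k) Aw; rewrite !mxE => ->.
  by congr f; apply/esym/updP.
suff fE X Y : f X = f Y by rewrite -(enum_valK x) -(enum_valK y) -!/(f _).
pose Z s := foldr (fun k Z => upd Z k (Y k)) X s.
have <- : f (Z (enum 'I_d)) = f X.
  by elim: (enum 'I_d) => //= k s <-; rewrite f_upd.
congr f; apply/ffunP => l.
have ZE s : Z s l = if l \in s then Y l else X l.
  elim: s => //= k s IH; rewrite inE eq_sym.
  by have [<-|kl] := eqVneq k l; rewrite ?upd_in// upd_out.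
by rewrite ZE mem_enum.
Qed.

End DirectionalOperators.

(** * The inner product without the cell volume *)

Section Dot.
Variables (R : realType) (m : nat).
Implicit Types (u v w : 'cV[R]_m) (A : 'M[R]_m) (c : R).

Definition dot u v : R := \sum_x u x 0 * v x 0.

Lemma dotE u v : dot u v = (u^T *m v) 0 0.
Proof. by rewrite mxE; apply: eq_bigr => x _; rewrite mxE. Qed.

Lemma dotC u v : dot u v = dot v u.
Proof. by apply: eq_bigr => x _; rewrite mulrC. Qed.

Lemma dotDr u v w : dot u (v + w) = dot u v + dot u w.
Proof. by rewrite !dotE mulmxDr mxE. Qed.

Lemma dotNr u v : dot u (- v) = - dot u v.
Proof. by rewrite !dotE mulmxN mxE. Qed.

Lemma dotZr c u v : dot u (c *: v) = c * dot u v.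
Proof. by rewrite !dotE -scalemxAr mxE. Qed.

Lemma dotDl u v w : dot (v + w) u = dot v u + dot w u.
Proof. by rewrite dotC dotDr !(dotC u). Qed.

Lemma dotNl u v : dot (- v) u = - dot v u.
Proof. by rewrite dotC dotNr dotC. Qed.

Lemma dot_sumr u (I : Type) (r : seq I) (P : pred I) (F : I -> 'cV[R]_m) :
  dot u (\sum_(i <- r | P i) F i) = \sum_(i <- r | P i) dot u (F i).
Proof.
elim/big_rec2: _ => [|i x y _ <-]; last by rewrite dotDr.
by rewrite /dot big1// => x _; rewrite mxE mulr0.
Qed.

Lemma dot_mulmx u A v : dot u (A *m v) = dot (A^T *m u) v.
Proof. by rewrite !dotE trmx_mul trmxK mulmxA. Qed.

Lemma dot_ge0 u : 0 <= dot u u.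
Proof. by apply: sumr_ge0 => x _; rewrite -expr2 sqr_ge0. Qed.

Lemma dot_eq0 u : dot u u = 0 -> u = 0.
Proof.
move=> /eqP; rewrite psumr_eq0 => [/allP u0|x _]; last first.
  by rewrite -expr2 sqr_ge0.
apply/colP => x; have := u0 x (mem_index_enum _).
by rewrite mulf_eq0 orbb mxE => /eqP.
Qed.

End Dot.

Arguments dot {R m} u v.
Arguments dotC {R m} u v.

Lemma inner_dot (R : realType) (d : nat) (lo hi : 'I_d -> R) (n : 'I_d -> nat)
    (u v : gridfun R n) :
  inner lo hi u v = (\prod_k ((hi k - lo k) / (n k)%:R)) * dot u v.
Proof. by []. Qed.

(** * The energy stability matrices as functions of the Laplacian *)

Section Bicommutant.
Variables (R : realType) (m : nat) (D : 'M[R]_m).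
Hypothesis D_sym : D^T = D.
Implicit Types (A B C L : 'M[R]_m) (a : nat -> nat -> R).

(* Every rational function of [D] qualifies; commuting with the whole commutant
   of [D], not only with [D], is what makes products symmetric again. *)
Definition bicomm A := A^T = A /\ (forall C, comm_mx C D -> comm_mx C A).

Lemma bicomm_id : bicomm D. Proof. by split. Qed.

Lemma bicomm0 : bicomm 0.
Proof. by split=> [|C _]; rewrite ?trmx0//; exact: comm_mx0. Qed.

Lemma bicomm1 : bicomm 1%:M.
Proof. by split=> [|C _]; rewrite ?trmx1//; exact: comm_mx1. Qed.

Lemma bicommD A B : bicomm A -> bicomm B -> bicomm (A + B).
Proof.
move=> [As Ac] [Bs Bc]; split=> [|C CD]; first by rewrite linearD /= As Bs.
by apply: comm_mxD; [exact: Ac | exact: Bc].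
Qed.

Lemma bicommM A B : bicomm A -> bicomm B -> bicomm (A *m B).
Proof.
move=> [As Ac] [Bs Bc]; split=> [|C CD]; last first.
  by apply: comm_mxM; [exact: Ac | exact: Bc].
rewrite trmx_mul As Bs; apply: Ac; apply: comm_mx_sym; apply: Bc.
exact: comm_mx_refl.
Qed.

Lemma bicommZ c A : bicomm A -> bicomm (c *: A).
Proof.
rewrite -mul_scalar_mx => bA; apply: bicommM => //.
by split=> [|C _]; rewrite ?tr_scalar_mx//; exact: comm_mx_scalar.
Qed.

Lemma bicommB A B : bicomm A -> bicomm B -> bicomm (A - B).
Proof. by move=> bA bB; rewrite -scaleN1r; apply/bicommD/bicommZ. Qed.

Lemma bicomm_sum (I : Type) (r : seq I) (P : pred I) (F : I -> 'M[R]_m) :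
  (forall i, P i -> bicomm (F i)) -> bicomm (\sum_(i <- r | P i) F i).
Proof.
move=> bF; elim/big_ind: _ => //; [exact: bicomm0 | exact: bicommD].
Qed.

Lemma bicommV A : bicomm A -> bicomm (invmx A).
Proof.
move=> [As Ac]; split=> [|C /Ac CA]; first by rewrite trmx_inv As.
have [uA|] := boolP (A \in unitmx); last first.
  (* By convention [invmx A] is [A] itself when [A] is singular. *)
  by rewrite unitmxE /invmx unitmxE => /negbTE ->.
rewrite /comm_mx -[LHS](mulKmx uA); congr (_ *m _).
by rewrite mulmxA -CA -mulmxA mulmxV ?mulmx1.
Qed.

Lemma bicomm_poly q A : bicomm A -> bicomm (poly_mx q A).
Proof.
move=> bA; apply: bicomm_sum => k _; apply: bicommZ.
by elim: (k : nat) => [|j IH]; [exact: bicomm1 | rewrite exprS; exact: bicommM].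
Qed.

(** Strong induction on the row: the recursion builds omega from [L] by sums, products, polynomials
    and inverses, all of which preserve [bicomm]. *)
Lemma bicomm_Delta a tau L i j :
  bicomm L -> (0 < j)%N -> bicomm (Delta a tau L i j).
Proof.
move=> bL j0; have bP k : bicomm (phimx a tau L k).
  exact/bicomm_poly/bicommZ.
suff bO k l : (0 < k)%N -> bicomm (omega a tau L k l).
  rewrite /Delta big_nat; apply: bicomm_sum => k /andP[jk ki].
  have [i0|i0] := posnP i; last exact: bO.
  by move: ki; rewrite i0 ltnS leqNgt (leq_trans j0 jk).
elim/ltn_ind: k l => k IH l k0; rewrite omegaE//.
apply: bicommD; first exact/bicommZ/bicommZ.
apply: bicommM; first exact/bicommV/bicommZ.
apply: bicommB; first by apply: bicommB; apply: bicommZ => //; exact: bicomm1.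
apply: bicomm_sum => jj _; apply/bicommZ/bicommM => //.
apply: bicommB; last exact/bicommZ/bicommZ.
by apply: IH => //; rewrite -[X in (_ < X)%N](prednK k0) ltnS.
Qed.

End Bicommutant.

(** Used for the all-ones vector, which the matrices phi_i therefore fix. *)
Lemma poly_mx_ker (R : realType) (m q : nat) (p : {poly R}) (A : 'M[R]_m)
    (v : 'M[R]_(m, q)) : A *m v = 0 -> poly_mx p A *m v = p`_0 *: v.
Proof.
move=> Av; rewrite /poly_mx; case E: (size p) => [|k].
  by rewrite big_ord0 mul0mx nth_default ?E// scale0r.
rewrite mulmx_suml big_ord_recl /= expr0 -scalemxAl mul1mx big1 ?addr0// => j _.
by rewrite exprSr -scalemxAl -mulmxE -mulmxA Av mulmx0 scaler0.
Qed.

(** * The stage equations in terms of the matrices omega *)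

Section StageIdentities.
Variables (R : realType) (m : nat) (a : nat -> nat -> R) (tau : R).
Variables (L : 'M[R]_m) (s : nat).
Local Notation P := (phimx a tau L).
Local Notation om := (omega a tau L).

Lemma phimx_horner m' (A : 'M[R]_m'.+1) i :
  phimx a tau A i = horner_mx (- tau *: A) (phi R i \Po (absc a i *: 'X)).
Proof.
rewrite /phimx /poly_mx comp_polyE rmorph_sum /=; apply: eq_bigr => k _.
rewrite -!mul_polyC !rmorphM rmorphXn /= rmorphM /= !horner_mx_C horner_mx_X.
by rewrite -!mulmxE !mul_scalar_mx scalerA mulrN.
Qed.

(** This is the polynomial identity evaluated at the matrix - tau L. *)
Lemma equilibrium_phimx : equilibrium_preserving s a ->
  forall i, (1 <= i <= s)%N ->
  P i = 1%:M - tau *: (L *m \sum_(j < i) a i j *: P j).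
Proof.
(* In size 0 all matrices are equal, which leaves the sizes [m'.+1] on which [horner_mx] acts. *)
move=> eqp i /eqp; clear eqp; case: m L => [|m'] A E.
  by rewrite [LHS]flatmx0 [RHS]flatmx0.
rewrite phimx_horner E rmorphD rmorph1 rmorphM /= horner_mx_X -mulmxE.
rewrite -scalemxAl.
rewrite scaleNr; congr (_ - _ *: (_ *m _)); rewrite rmorph_sum /=.
apply: eq_bigr => j _; rewrite phimx_horner.
by rewrite -mul_polyC rmorphM /= horner_mx_C -mulmxE mul_scalar_mx.
Qed.

Hypothesis Pu : forall i, (1 <= i <= s)%N -> P i \in unitmx.
Hypothesis a_neq0 : forall i, (1 <= i <= s)%N -> a i i.-1 != 0.

Lemma phimx0 : P 0 = 1%:M.
Proof.
have phi0 : phi R 0 = 1.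
  by rewrite /phi poly_def big_ord1 fact0 invr1 scale1r.
by rewrite /phimx /poly_mx phi0 size_poly1 big_ord1 coef1 expr0 scale1r.
Qed.

(** The range independent of [i] allows sums to be exchanged in [omega_stage]; the range ending at
    [i] is the one for summation by parts. *)
Lemma omega_sum_trunc q (X : nat -> 'M[R]_(m, q)) i : (i <= s)%N ->
  \sum_(0 <= k < i.+1) om i k *m X k = \sum_(k < s.+1) om i k *m X k.
Proof.
move=> lis; rewrite -(big_mkord xpredT (fun k => om i k *m X k)).
rewrite (@big_cat_nat _ _ _ i.+1 0 s.+1)//=.
rewrite -[LHS]addr0; congr (_ + _); apply/esym; rewrite big_nat big1// => k.
by move=> /andP[ik _]; rewrite omega_eq0 ?mul0mx.
Qed.

(* Applied to the stages with Y = N(X), and to X = 1, Y = - L, where it says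
   that the omega_{i,k} sum to 0. *)
Lemma omega_stage q (X Y : nat -> 'M[R]_(m, q)) :
  (forall i, (1 <= i <= s)%N ->
     P i *m X i = X 0%N + tau *: \sum_(j < i) a i j *: (P j *m Y j)) ->
  forall i, (1 <= i <= s)%N ->
  \sum_(k < s.+1) om i k *m X k = tau *: (L *m X i + Y i.-1).
Proof.
move=> HX; elim/ltn_ind=> i IH /andP[i1 is_].
have sum_delta (F : nat -> 'M[R]_m) j : (j <= s)%N ->
    \sum_(k < s.+1) ((k == j :> nat)%:R *: F j) *m X k = F j *m X j.
  move=> js; have jN : (j < s.+1)%N by [].
  rewrite (bigD1 (Ordinal jN))//= eqxx scale1r big1 ?addr0// => k.
  by rewrite -val_eqE /= => /negbTE ->; rewrite scale0r mul0mx.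
under eq_bigr do rewrite omegaE// mulmxDl -mulmxA mulmxBl mulmxBl mulmx_suml.
rewrite big_split /= (sum_delta (fun=> tau *: L))// -mulmx_sumr !sumrB.
rewrite (sum_delta P)// (sum_delta (fun=> 1%:M))// mul1mx exchange_big /=.
(* By induction the sum over k of the omega terms is tau (L X_{j+1} + Y_j), and the Kronecker term
   removes tau L X_{j+1}. *)
have -> : \sum_(j < i.-1) \sum_(k < s.+1) a i j *:
     (P j *m (om j.+1 k - (k == j.+1 :> nat)%:R *: (tau *: L))) *m X k
   = tau *: \sum_(j < i.-1) a i j *: (P j *m Y j).
  rewrite scaler_sumr; apply: eq_bigr => j _.
  have ji : (j.+1 < i)%N by rewrite -[X in (_ < X)%N](prednK i1) ltnS.
  have js : (j.+1 <= s)%N by apply: leq_trans (ltnW ji) is_.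
  transitivity (a i j *: (P j *m (\sum_(k < s.+1) om j.+1 k *m X k
     - \sum_(k < s.+1) ((k == j.+1 :> nat)%:R *: (tau *: L)) *m X k))).
    rewrite -sumrB mulmx_sumr scaler_sumr; apply: eq_bigr => k _.
    by rewrite -scalemxAl -mulmxA mulmxBl.
  rewrite (sum_delta (fun=> tau *: L))// IH//= scalerDr -scalemxAl addrC addKr.
  by rewrite -scalemxAr !scalerA mulrC.
(* Once the stage equation is inserted, X_0 and all terms with j < i - 1 cancel; the inverse in the
   recursion removes the factor of the last term. *)
rewrite HX ?i1// [X in X - _ - _]addrC addrK.
have -> : \sum_(j < i) a i j *: (P j *m Y j) =
  \sum_(j < i.-1) a i j *: (P j *m Y j) + a i i.-1 *: (P i.-1 *m Y i.-1).
  by case: (i) i1 => // k _; rewrite big_ord_recr.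
rewrite scalerDr [X in X - _]addrC addrK scalerDr scalemxAl; congr (_ + _).
  by rewrite scalemxAl.
rewrite -scalemxAr mulKmx//.
rewrite unitmxZ ?unitfE ?a_neq0 ?i1//.
(* [Pu] starts at index 1; the first stage needs the factor P_0, which is the identity. *)
case: (i) i1 is_ => [//|[|k]] _ ks; first by rewrite phimx0 unitmx1.
by apply: Pu; rewrite /= ltnW.
Qed.

(** For X = 1 and Y = - L the stage equation is [equilibrium_phimx], up to moving [L] past the
    matrices P_j, and the right-hand side tau (L - L) is 0. *)
Lemma omega_row_sum : equilibrium_preserving s a ->
  (forall j, L *m P j = P j *m L) ->
  forall i, (1 <= i <= s)%N -> \sum_(0 <= k < i.+1) om i k = 0.
Proof.
move=> eqp LP i is_; have /andP[i1 lis] := is_.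
have := omega_stage m (fun=> 1%:M) (fun=> - L) _ i is_.
rewrite mulmx1 subrr scaler0 -(omega_sum_trunc m (fun=> 1%:M))//.
under eq_bigr do rewrite mulmx1.
apply => j /(equilibrium_phimx eqp) Pj; rewrite mulmx1 {1}Pj; congr (_ + _).
rewrite -scalerN mulmx_sumr -sumrN; congr (_ *: _).
by apply: eq_bigr => l _; rewrite -scalemxAr LP mulmxN scalerN.
Qed.

End StageIdentities.

(** * Summation by parts and triangular double sums *)

Lemma sum_abel (R : nzRingType) (m q : nat) (W : nat -> 'M[R]_m)
    (X : nat -> 'M[R]_(m, q)) i :
  \sum_(0 <= k < i.+1) W k *m X k
  = (\sum_(0 <= k < i.+1) W k) *m X 0%N
    + \sum_(1 <= j < i.+1)
        (\sum_(j <= k < i.+1) W k) *m (X j - X j.-1).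
Proof.
elim: i => [|i IH]; first by rewrite !big_nat1 big_geq// addr0.
(* The new index adds W_{i+1} to every tail; its contributions telescope to W_{i+1} (X_{i+1} -
   X_0). *)
have -> : \sum_(1 <= j < i.+2) (\sum_(j <= k < i.+2) W k) *m (X j - X j.-1)
    = \sum_(1 <= j < i.+2) (\sum_(j <= k < i.+1) W k) *m (X j - X j.-1)
      + \sum_(1 <= j < i.+2) W i.+1 *m (X j - X j.-1).
  rewrite -big_split; apply: eq_big_nat => j /andP[_ ji] /=.
  by rewrite big_nat_recr//= mulmxDl.
rewrite (@big_nat_recr _ _ _ i.+1 1%N)//= (@big_geq _ _ _ i.+1)// mul0mx addr0.
rewrite (@big_nat_recr _ _ _ i.+1 0%N)//= IH.
rewrite (@big_nat_recr _ _ _ i.+1 0%N W)//=.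
rewrite mulmxDl -!addrA; congr (_ + _); rewrite addrCA; congr (_ + _).
rewrite -mulmx_sumr -mulmxDr; congr (_ *m _).
by rewrite big_add1 /= telescope_sumr// addrC subrK.
Qed.

(** Here [b i j k l] stands for the form of index (i, j) at the vectors k and l. Each off-diagonal
    term is charged half to vector i and half to vector j; the total charge on vector i is what the
    second hypothesis subtracts from [b i i i i]. *)
Lemma triangular_sum_ge0 (R : realFieldType) (s : nat)
    (b : nat -> nat -> nat -> nat -> R) :
  (forall i j, (1 <= j)%N -> (j < i)%N -> (i <= s)%N ->
     - (2^-1 * b i j i i + 2^-1 * b i j j j) <= b i j i j) ->
  (forall i, (1 <= i <= s)%N ->
     0 <= b i i i i - 2^-1 * \sum_(1 <= j < i) b i j i i
          - 2^-1 * \sum_(i.+1 <= j < s.+1) b j i i i) ->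
  0 <= \sum_(1 <= i < s.+1) \sum_(1 <= j < i.+1) b i j i j.
Proof.
move=> cross diag; apply: (@le_trans _ _ (\sum_(1 <= i < s.+1)
   (b i i i i - 2^-1 * \sum_(1 <= j < i) b i j i i
          - 2^-1 * \sum_(i.+1 <= j < s.+1) b j i i i))).
  by rewrite big_nat; apply: sumr_ge0 => i; rewrite ltnS; exact: diag.
(* Both sides run over the pairs j < i, summed in opposite orders. *)
have swap : \sum_(1 <= i < s.+1) \sum_(i.+1 <= j < s.+1) b j i i i
          = \sum_(1 <= i < s.+1) \sum_(1 <= j < i) b i j j j.
  rewrite [RHS](eq_big_nat _ _ (F2 := fun i =>
    \sum_(1 <= j < s.+1 | (j < i)%N) b i j j j)); last first.
    move=> i /andP[_ is_]; rewrite (@big_nat_widen _ _ _ 1 i s.+1)//.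
    exact: ltnW.
  rewrite (exchange_big_dep_nat predT)//=; apply: eq_big_nat => j /andP[j1 js].
  rewrite (@big_nat_widenl _ _ _ j.+1 1 s.+1)//.
have -> : \sum_(1 <= i < s.+1) \sum_(1 <= j < i.+1) b i j i j
    = \sum_(1 <= i < s.+1) \sum_(1 <= j < i) b i j i j
      + \sum_(1 <= i < s.+1) b i i i i.
  rewrite -big_split; apply: eq_big_nat => i /andP[i1 _] /=.
  by rewrite big_nat_recr.
have : \sum_(1 <= i < s.+1) \sum_(1 <= j < i)
          - (2^-1 * b i j i i + 2^-1 * b i j j j)
     <= \sum_(1 <= i < s.+1) \sum_(1 <= j < i) b i j i j.
  apply: ler_sum_nat => i /andP[_ is_]; apply: ler_sum_nat => j /andP[j1 ji].
  exact: cross.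
rewrite !sumrB -!mulr_sumr swap.
under eq_bigr do rewrite sumrN big_split /= -!mulr_sumr.
by rewrite sumrN big_split /= -!mulr_sumr; lra.
Qed.

(** * Energy estimate between consecutive stages *)

Lemma potential_le (R : realFieldType) (beta kappa x y : R) :
  `|x| <= beta -> `|y| <= beta -> 2^-1 * (3 * beta ^+ 2 - 1) <= kappa ->
  4^-1 * (y ^+ 2 - 1) ^+ 2 - 4^-1 * (x ^+ 2 - 1) ^+ 2
  <= (y - x) * (x ^+ 3 - x + kappa * (y - x)).
Proof.
move=> xb yb kb; rewrite -subr_ge0.
have -> : (y - x) * (x ^+ 3 - x + kappa * (y - x))
    - (4^-1 * (y ^+ 2 - 1) ^+ 2 - 4^-1 * (x ^+ 2 - 1) ^+ 2)
  = (y - x) ^+ 2 * (kappa - 4^-1 * (3 * x ^+ 2 + 2 * (x * y) + y ^+ 2 - 2)).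
  by field.
(* It remains to bound (3 x^2 + 2 x y + y^2 - 2) / 4 by (3 beta^2 - 1) / 2. *)
have sqr_le z : `|z| <= beta -> z ^+ 2 <= beta ^+ 2.
  move=> zb; rewrite -(real_normK (num_real z)) ler_sqr ?nnegrE//.
  exact: le_trans zb.
have x2 := sqr_le x xb; have y2 := sqr_le y yb.
apply: mulr_ge0; first exact: sqr_ge0.
(* From 2 x y <= x^2 + y^2, the quadratic form is at most 4 x^2 + 2 y^2 <= 6 beta^2. *)
have := sqr_ge0 (x - y); rewrite sqrrB -mulr_natl.
by lra.
Qed.

Lemma derive1_nonlin (R : realType) (x : R) :
  (@nonlin R)^`()%classic x = 3 * x ^+ 2 - 1.
Proof.
have -> : @nonlin R = horner ('X^3 - 'X).
  by apply/funext => y; rewrite !hornerE.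
have [_] := is_derive_poly ('X^3 - 'X : {poly R}) x; rewrite derive1E => ->.
rewrite derivB derivXn derivX -polyC1 hornerD hornerN hornerMn hornerXn hornerC.
by rewrite mulr_natl.
Qed.

Section StageEnergy.
Variables (R : realType) (m : nat) (D : 'M[R]_m) (eps kappa beta : R).
Hypothesis D_sym : D^T = D.
Hypothesis D_le0 : forall v, dot v (D *m v) <= 0.
Hypothesis kappa_ge : 2^-1 * (3 * beta ^+ 2 - 1) <= kappa.
Implicit Types u v : 'cV[R]_m.

(** The discrete energy divided by the volume of a grid cell. *)
Definition dot_energy u :=
  - (eps ^+ 2 / 2) * dot u (D *m u) + \sum_x potential (u x 0).

(** The chemical potential of the scheme: implicit in the quadratic part, explicit in the
    nonlinearity, with the stabilization as a penalty on v - u. *)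
Definition dot_gradient u v :=
  - eps ^+ 2 *: (D *m v) + kappa *: (v - u) + map_mx (@nonlin R) u.

Lemma dot_energy_le u v :
  (forall x, `|u x 0| <= beta) -> (forall x, `|v x 0| <= beta) ->
  dot_energy v - dot_energy u <= dot (v - u) (dot_gradient u v).
Proof.
move=> ub vb; rewrite /dot_gradient -[X in dot _ X]addrA [leRHS]dotDr.
(* The two sides differ by eps^2 / 2 times - <v - u, D (v - u)>, which is nonnegative. *)
have quad : - (eps ^+ 2 / 2) * dot v (D *m v) + eps ^+ 2 / 2 * dot u (D *m u)
    <= dot (v - u) (- eps ^+ 2 *: (D *m v)).
  have := D_le0 (v - u); rewrite mulmxBr dotDl !dotDr !dotNl !dotNr.
  rewrite [dot v (D *m u)]dot_mulmx D_sym [dot (D *m v) u]dotC => Dvu.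
  rewrite dotZr dotDl dotNl -subr_ge0.
  have -> : - eps ^+ 2 * (dot v (D *m v) - dot u (D *m v))
     - (- (eps ^+ 2 / 2) * dot v (D *m v) + eps ^+ 2 / 2 * dot u (D *m u))
    = eps ^+ 2 / 2 * - (dot v (D *m v) - dot u (D *m v)
        - (dot u (D *m v) - dot u (D *m u))).
    by field.
  apply: mulr_ge0; first by rewrite divr_ge0 ?sqr_ge0.
  by move: Dvu; lra.
have pot : \sum_x potential (v x 0) - \sum_x potential (u x 0)
    <= dot (v - u) (kappa *: (v - u) + map_mx (@nonlin R) u).
  rewrite -sumrB; apply: ler_sum => x _.
  rewrite !mxE [kappa * _ + _]addrC; exact: potential_le kappa_ge.
by rewrite /dot_energy; move: quad pot; lra.
Qed.

End StageEnergy.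

(** * Energy decay over one step *)

Section GradientStructure.
Variables (R : realType) (m : nat) (I : finType) (G : I -> 'M[R]_m).
Variable D : 'M[R]_m.
Local Notation one := (const_mx 1 : 'cV[R]_m).
Hypothesis G_sym : forall k, (G k)^T = G k.
Hypothesis G_one : forall k, G k *m one = 0.
Hypothesis G_comm : forall k l, G k *m G l = G l *m G k.
Hypothesis G_ker : forall v : 'cV[R]_m,
  (forall k, G k *m v = 0) -> forall x y, v x 0 = v y 0.
Hypothesis D_def : D = - \sum_k G k *m G k.

Lemma gradsum_sym : D^T = D.
Proof.
rewrite D_def linearN /= linear_sum /=; congr (- _); apply: eq_bigr => k _.
by rewrite trmx_mul !G_sym.
Qed.

Lemma gradsum_one : D *m one = 0.
Proof.
rewrite D_def mulNmx mulmx_suml big1 ?oppr0// => k _.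
by rewrite -mulmxA G_one mulmx0.
Qed.

Lemma dot_one_gradsum v : dot one (D *m v) = 0.
Proof.
rewrite dot_mulmx gradsum_sym gradsum_one /dot big1// => x _.
by rewrite mxE mul0r.
Qed.

Lemma dot_gradsum v : dot v (D *m v) = - \sum_k dot (G k *m v) (G k *m v).
Proof.
rewrite D_def mulNmx dotNr mulmx_suml dot_sumr; congr (- _).
by apply: eq_bigr => k _; rewrite -mulmxA [LHS]dot_mulmx G_sym.
Qed.

Lemma gradsum_le0 v : dot v (D *m v) <= 0.
Proof.
by rewrite dot_gradsum oppr_le0; apply: sumr_ge0 => k _; exact: dot_ge0.
Qed.

Lemma G_comm_D k : comm_mx (G k) D.
Proof.
rewrite D_def; apply/comm_mxN/comm_mx_sum => l _.
by apply: comm_mxM; exact: G_comm.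
Qed.

(* On mean-zero vectors [D] is invertible, and subtracting the all-ones matrix
   makes it invertible everywhere. *)
Definition potential_of (w : 'cV[R]_m) := invmx (D - const_mx 1) *m w.

Lemma const1_mul (v : 'cV[R]_m) :
  (const_mx 1 : 'M[R]_m) *m v = dot one v *: one.
Proof.
apply/colP => x; rewrite !mxE mulr1.
by apply: eq_bigr => y _; rewrite !mxE.
Qed.

(** For v in the kernel, pairing with v gives <v, D v> - <1, v>^2 = 0. Both terms are nonpositive,
    so both vanish: every G_k v is 0, hence v is constant, and its sum is 0. *)
Lemma gradsum_sub1_unit : D - const_mx 1 \in unitmx.
Proof.
rewrite -row_free_unit; apply: inj_row_free => r /(congr1 trmx).
rewrite trmx_mul linearB /= gradsum_sym trmx_const trmx0 => Dr.
suff: r^T = 0 by move/(congr1 trmx); rewrite trmxK trmx0.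
move: Dr; set v := r^T; rewrite mulmxBl const1_mul => Dv.
have vDv : dot v (D *m v) - dot one v ^+ 2 = 0.
  have := congr1 (dot v) Dv.
  rewrite dotDr dotNr dotZr (dotC v one) -expr2 => ->.
  by rewrite /dot big1// => x _; rewrite [X in _ * X]mxE mulr0.
have sv := gradsum_le0 v; have v1 : dot one v = 0.
  by apply/eqP; rewrite -sqrf_eq0; apply/eqP; have := sqr_ge0 (dot one v); lra.
have Gv k : G k *m v = 0.
  apply: dot_eq0; move: vDv; rewrite v1 expr0n subr0 dot_gradsum => /eqP.
  rewrite oppr_eq0 psumr_eq0 => [/allP/(_ k (mem_index_enum _))/eqP//|l _].
  exact: dot_ge0.
apply/colP => x; rewrite [RHS]mxE; have vx y : v y 0 = v x 0 by exact: G_ker.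
have /eqP : m%:R * v x 0 = 0.
  rewrite -[RHS]v1 /dot (eq_bigr (fun=> v x 0)) => [|y _]; last first.
    by rewrite mxE mul1r.
  by rewrite sumr_const card_ord mulr_natl.
have m0 : (0 < m)%N by exact: leq_ltn_trans (ltn_ord x).
by rewrite mulf_eq0 pnatr_eq0 gtn_eqF//= => /eqP.
Qed.

(** By construction D q - <1, q> 1 = w. Pairing with 1 annihilates D q and w, so <1, q> <1, 1> =
    0. *)
Lemma potential_ofK w : dot one w = 0 -> D *m potential_of w = w.
Proof.
move=> w0; set q := potential_of w.
have qE : D *m q - dot one q *: one = w.
  by rewrite -const1_mul -mulmxBl /q /potential_of mulKVmx// gradsum_sub1_unit.
have : dot one (D *m q - dot one q *: one) = 0 by rewrite qE.
rewrite dotDr dot_one_gradsum add0r dotNr dotZr => /eqP.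
(* The second case, in which the all-ones vector is 0, is that of dimension 0. *)
rewrite oppr_eq0 mulf_eq0 => /orP[/eqP q0|/eqP /dot_eq0 one0].
  by rewrite -[RHS]qE q0 scale0r subr0.
by rewrite -[RHS]qE one0 scaler0 subr0.
Qed.

Definition gform (M : 'M[R]_m) (p q : 'cV[R]_m) := - dot p (M *m (D *m q)).

Definition psd0 (M : 'M[R]_m) :=
  forall v, dot one v = 0 -> 0 <= dot v (M *m v).

(** [M] commutes with each [G k], since [G k] commutes with [D]. The vectors [G k *m p] have mean
    zero for every [p], so [psd0] applies to them. *)
Lemma gformE M p q : bicomm R m D M ->
  gform M p q = \sum_k dot (G k *m p) (M *m (G k *m q)).
Proof.
move=> [Ms Mc]; rewrite /gform D_def mulNmx mulmxN dotNr opprK mulmx_suml.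
rewrite mulmx_sumr dot_sumr; apply: eq_bigr => k _.
transitivity (dot p (G k *m (M *m (G k *m q)))).
  by rewrite !mulmxA (Mc _ (G_comm_D k)).
by rewrite [LHS]dot_mulmx G_sym.
Qed.

Lemma gformC M p q : bicomm R m D M -> gform M p q = gform M q p.
Proof.
move=> bM; rewrite !gformE//; apply: eq_bigr => k _.
by rewrite dot_mulmx (proj1 bM) dotC.
Qed.

Lemma gform_ge0 M q : bicomm R m D M -> psd0 M -> 0 <= gform M q q.
Proof.
move=> bM pM; rewrite gformE//; apply: sumr_ge0 => k _; apply: pM.
by rewrite dot_mulmx G_sym G_one /dot big1// => x _; rewrite mxE mul0r.
Qed.

Lemma gformDl M p q r : gform M (p + q) r = gform M p r + gform M q r.
Proof. by rewrite /gform dotDl opprD. Qed.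

Lemma gformDr M p q r : gform M r (p + q) = gform M r p + gform M r q.
Proof. by rewrite /gform !mulmxDr dotDr opprD. Qed.

Lemma gform_cross M p q : bicomm R m D M -> psd0 M ->
  - (2^-1 * gform M p p + 2^-1 * gform M q q) <= gform M p q.
Proof.
move=> bM pM; have := gform_ge0 M (p + q) bM pM.
by rewrite gformDl !gformDr (gformC M q p bM); lra.
Qed.

Lemma gformBl M N p q : gform (M - N) p q = gform M p q - gform N p q.
Proof. by rewrite /gform mulmxBl dotDr dotNr opprD opprK. Qed.

Lemma gformZl c M p q : gform (c *: M) p q = c * gform M p q.
Proof. by rewrite /gform -scalemxAl dotZr mulrN. Qed.

Lemma gform_suml (J : Type) (r : seq J) (Q : pred J) (F : J -> 'M[R]_m) p q :
  gform (\sum_(j <- r | Q j) F j) p q = \sum_(j <- r | Q j) gform (F j) p q.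
Proof. by rewrite /gform mulmx_suml dot_sumr sumrN. Qed.

Section OneStep.
Variables (eps kappa beta tau : R) (s : nat) (a : nat -> nat -> R).
Variable X : nat -> 'cV[R]_m.
Let L : 'M[R]_m := D *m (- eps ^+ 2 *: D + kappa%:M).
Let Y j : 'cV[R]_m := D *m map_mx (@nonlin R) (X j) - kappa *: (D *m X j).
Local Notation P := (phimx a tau L).
Local Notation Del := (Delta a tau L).
Hypothesis tau_gt0 : 0 < tau.
Hypothesis eqp : equilibrium_preserving s a.
Hypothesis Pu : forall i, (1 <= i <= s)%N -> P i \in unitmx.
Hypothesis a_neq0 : forall i, (1 <= i <= s)%N -> a i i.-1 != 0.
Hypothesis kappa_ge : 2^-1 * (3 * beta ^+ 2 - 1) <= kappa.
Hypothesis X_le : forall i x, (i <= s)%N -> `|X i x 0| <= beta.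
Hypothesis stageX : forall i, (1 <= i <= s)%N ->
  P i *m X i = X 0%N + tau *: \sum_(j < i) a i j *: (P j *m Y j).

Lemma bicomm_stiff : bicomm R m D L.
Proof.
have bD := bicomm_id R m D gradsum_sym.
apply: bicommM => //; apply: bicommD; first exact: bicommZ.
by rewrite -scalemx1; apply: bicommZ; exact: bicomm1.
Qed.

Lemma bicomm_phimx i : bicomm R m D (P i).
Proof. by apply: bicomm_poly; apply: bicommZ; exact: bicomm_stiff. Qed.

Lemma phimx_one i : P i *m one = one.
Proof.
have L1 : L *m one = 0.
  rewrite /L -mulmxA mulmxDl -scalemxAl gradsum_one scaler0 add0r.
  by rewrite mul_scalar_mx -scalemxAr gradsum_one scaler0.
rewrite /phimx poly_mx_ker; last by rewrite -scalemxAl L1 scaler0.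
by rewrite coef_poly /= fact0 invr1 scale1r.
Qed.

Lemma dot_one_phimx i v : dot one (P i *m v) = dot one v.
Proof. by rewrite dot_mulmx (proj1 (bicomm_phimx i)) phimx_one. Qed.

(** Conservation of mass: the symmetric matrices P_j fix the all-ones vector, and each Y_j lies in
    the range of [D], which is orthogonal to it. *)
Lemma dot_one_stage i : (i <= s)%N -> dot one (X i) = dot one (X 0%N).
Proof.
have [->//|i0 lis] := posnP i.
rewrite -(dot_one_phimx i) stageX ?i0// dotDr dotZr dot_sumr.
rewrite big1 ?mulr0 ?addr0// => j _.
rewrite dotZr dot_one_phimx /Y scalemxAr -mulmxBr dot_one_gradsum.
by rewrite mulr0.
Qed.

Let w i := X i - X i.-1.
Let q i := potential_of (w i).

Lemma D_pot i : (i <= s)%N -> D *m q i = w i.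
Proof.
move=> lis; apply: potential_ofK; rewrite dotDr dotNr !dot_one_stage ?subrr//.
exact: leq_trans (leq_pred i) lis.
Qed.

(** In [sum_abel] the tails of the row omega_{i,.} are the matrices Delta_{i,j}, and the boundary
    term vanishes by [omega_row_sum]. *)
Lemma gradsum_dot_gradient i : (1 <= i <= s)%N ->
  tau *: (D *m dot_gradient R m D eps kappa (X i.-1) (X i))
  = \sum_(1 <= j < i.+1) Del i j *m (D *m q j).
Proof.
move=> is_; have /andP[i1 lis] := is_.
have := omega_stage R m a tau L s Pu a_neq0 1 X Y stageX i is_.
rewrite -omega_sum_trunc// sum_abel.
rewrite (omega_row_sum R m a tau L s Pu a_neq0 eqp _ i is_); last first.
  move=> j; apply: (proj2 (bicomm_phimx j)).
  exact/comm_mx_sym/(proj2 bicomm_stiff)/comm_mx_refl.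
rewrite mul0mx add0r => sumE.
(* The stabilization terms of [L] and [Y] combine to kappa D (X_i - X_{i-1}). *)
transitivity (tau *: (L *m X i + Y i.-1)).
  congr (_ *: _); rewrite /dot_gradient /L /Y !mulmxDr mulmxDl.
  rewrite -!mulmxA -scalemxAl mul_scalar_mx -!scalemxAr mulmxBr scalerBr.
  rewrite -!addrA.
  by congr (_ + (_ + _)); rewrite addrC.
rewrite -sumE; apply: eq_big_nat => j /andP[_]; rewrite ltnS => ji.
by rewrite D_pot// (leq_trans ji lis).
Qed.

Lemma dot_energy_step i : (1 <= i <= s)%N ->
  dot_energy R m D eps (X i) - dot_energy R m D eps (X i.-1)
  <= - (tau^-1 * \sum_(1 <= j < i.+1) gform (Del i j) (q i) (q j)).
Proof.
move=> is_; have /andP[i1 lis] := is_.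
have pis : (i.-1 <= s)%N by exact: leq_trans (leq_pred i) lis.
apply: le_trans (dot_energy_le R m D eps kappa beta gradsum_sym gradsum_le0
  kappa_ge (X i.-1) (X i) _ _) _ => [x|x|]; [exact: X_le|exact: X_le|].
(* With w_i = D q_i, symmetry moves [D] from q_i onto the gradient. *)
rewrite -/(w i) -(D_pot i lis) -[X in dot (X *m _) _]gradsum_sym -dot_mulmx.
have -> : D *m dot_gradient R m D eps kappa (X i.-1) (X i)
   = tau^-1 *: \sum_(1 <= j < i.+1) Del i j *m (D *m q j).
  by rewrite -gradsum_dot_gradient// scalerA mulVf ?gt_eqF// scale1r.
by rewrite dotZr dot_sumr /gform sumrN mulrN opprK.
Qed.

Hypothesis psd_off : forall i j, (1 <= j)%N -> (j < i)%N -> (i <= s)%N ->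
  psd0 (Del i j).
Hypothesis psd_diag : forall i, (1 <= i <= s)%N ->
  psd0 (Del i i - 2^-1 *: \sum_(1 <= j < i) Del i j
        - 2^-1 *: \sum_(i.+1 <= j < s.+1) Del j i).

Lemma dot_energy_decay :
  dot_energy R m D eps (X s) <= dot_energy R m D eps (X 0%N).
Proof.
have bD i j : (0 < j)%N -> bicomm R m D (Del i j).
  by apply: bicomm_Delta; exact: bicomm_stiff.
pose En i := dot_energy R m D eps (X i).
rewrite -subr_le0 -(telescope_sumr En (leq0n s)) /En.
rewrite -(big_add1 _ _ 0 s.+1 xpredT
  (fun i => dot_energy R m D eps (X i) - dot_energy R m D eps (X i.-1))).
apply: (@le_trans _ _ (\sum_(1 <= i < s.+1)
   - (tau^-1 * \sum_(1 <= j < i.+1) gform (Del i j) (q i) (q j)))).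
  by apply: ler_sum_nat => i; exact: dot_energy_step.
rewrite sumrN -mulr_sumr oppr_le0 mulr_ge0 ?invr_ge0 ?(ltW tau_gt0)//.
apply: (triangular_sum_ge0 R s (fun i j k l => gform (Del i j) (q k) (q l))).
  move=> i j j1 ji lis; apply: gform_cross; first exact: bD.
  exact: psd_off.
move=> i is_; have /andP[i1 lis] := is_.
(* Linearity of [gform] in its matrix assembles the diagonal stability matrix. *)
rewrite -!gform_suml -!gformZl -!gformBl.
apply: gform_ge0; last exact: psd_diag.
apply: bicommB; first (apply: bicommB; first exact: bD).
  by rewrite big_nat; apply/bicommZ/bicomm_sum => // j /andP[j1 _]; exact: bD.
by apply/bicommZ/bicomm_sum => // j _; exact: bD.
Qed.

End OneStep.

End GradientStructure.

(** * Square roots of the directional Laplacians *)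

Lemma laplacian1E (R : realType) (len : R) m :
  laplacian1 len m = fourier_mult R m (fourier_symbol len m).
Proof. by []. Qed.

Lemma fourier_symbol_refl (R : realType) (len : R) m :
  reflecting R m (fourier_symbol len m).
Proof.
move=> l /andP[l0 lm]; rewrite /fourier_symbol natrB; last exact: ltnW.
have := odd_double_half m; set h := m./2 => mE.
(* If l and m - l both lie in the lower half, then l is the middle frequency and m = 2 l; they
   cannot both lie in the upper half. *)
have [lh|lh] := leqP l h; have [lh'|lh'] := leqP (m - l) h.
- have -> : m%:R = (l + l)%:R :> R by congr _%:R; lia.
  by rewrite natrD addrK.
- by congr (- _); rewrite addrAC subrr sub0r mulrN sqrrN.
- by congr (- _); rewrite -sqrrN -mulrN opprB.
- by lia.
Qed.

Lemma fourier_symbol0 (R : realType) (len : R) m : fourier_symbol len m 0 = 0.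
Proof. by rewrite /fourier_symbol leq0n mulr0 expr0n oppr0. Qed.

Lemma fourier_symbol_le0 (R : realType) (len : R) m l :
  fourier_symbol len m l <= 0.
Proof. by rewrite /fourier_symbol; case: ifP; rewrite oppr_le0 sqr_ge0. Qed.

Lemma fourier_symbol_neq0 (R : realType) (len : R) m l : 0 < len ->
  (0 < l < m)%N -> fourier_symbol len m l != 0.
Proof.
move=> len0 /andP[l0 lm]; have mu0 : 2 * pi / len != 0.
  by rewrite gt_eqF// divr_gt0// mulr_gt0// pi_gt0.
rewrite /fourier_symbol; case: ifP => _; rewrite oppr_eq0 expf_eq0 /=.
  by rewrite mulf_neq0// pnatr_eq0 -lt0n.
by rewrite mulf_neq0// subr_eq0 eqr_nat ltn_eqF.
Qed.

(** The symbol is the modulus of the frequency, not i times it as for the spectral derivative, so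
    that this root is real and symmetric. *)
Definition grad1 (R : realType) (len : R) m : 'M[R]_m :=
  fourier_mult R m (fun l => Num.sqrt (- fourier_symbol len m l)).

Lemma grad1_refl (R : realType) (len : R) m :
  reflecting R m (fun l => Num.sqrt (- fourier_symbol len m l)).
Proof. by move=> l lm; rewrite fourier_symbol_refl. Qed.

Lemma grad1_sqr (R : realType) (len : R) m : (0 < m)%N ->
  grad1 R len m *m grad1 R len m = - laplacian1 len m.
Proof.
move=> m0; have rf := grad1_refl R len m.
rewrite laplacian1E /grad1 (fourier_multM _ _ _ _ m0 rf rf).
transitivity (fourier_mult R m (fun l => - fourier_symbol len m l)).
  congr fourier_mult; apply/funext => l.
  by rewrite -expr2 sqr_sqrtr// oppr_ge0 fourier_symbol_le0.
by apply: fourier_multN => //; exact: fourier_symbol_refl.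
Qed.

Section Grid.
Variables (R : realType) (d : nat) (lo hi : 'I_d -> R) (n : 'I_d -> nat).
Hypothesis lohi : forall k, lo k < hi k.
Hypothesis n_gt0 : forall k, (0 < n k)%N.

Definition gridgrad k : 'M[R]_#|gridpt n| :=
  dirmx R d n k (grad1 R (hi k - lo k) (n k)).

Lemma gridgrad_sym k : (gridgrad k)^T = gridgrad k.
Proof.
rewrite tr_dirmx /grad1 fourier_mult_sym//; exact: grad1_refl.
Qed.

Lemma gridgrad_one k : gridgrad k *m const_mx 1 = 0 :> 'cV_#|gridpt n|.
Proof.
apply: dirmx_const1; apply: fourier_mult_const1 => //.
  exact: grad1_refl.
by rewrite fourier_symbol0 oppr0 sqrtr0.
Qed.

Lemma gridgrad_comm k l : gridgrad k *m gridgrad l = gridgrad l *m gridgrad k.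
Proof. by have [->//|kl] := eqVneq k l; exact: dirmxC. Qed.

Lemma gridgrad_ker (v : gridfun R n) :
  (forall k, gridgrad k *m v = 0) -> forall x y, v x 0 = v y 0.
Proof.
apply: dirmx_ker => k w i j; apply: fourier_mult_ker => //.
  exact: grad1_refl.
move=> l lm; rewrite sqrtr_eq0 -ltNge oppr_gt0 lt_neqAle fourier_symbol_le0.
by rewrite fourier_symbol_neq0// subr_gt0.
Qed.

Lemma laplacian_gridgrad :
  laplacian lo hi n = - \sum_k gridgrad k *m gridgrad k.
Proof.
rewrite laplacianE -sumrN; apply: eq_bigr => k _.
by rewrite /gridgrad dirmxM grad1_sqr// dirmxN opprK.
Qed.

End Grid.

(** * Back to the weighted energy and the theorem *)

Lemma energyE (R : realType) (d : nat) (lo hi : 'I_d -> R) (n : 'I_d -> nat)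
    (eps : R) (u : gridfun R n) :
  energy lo hi eps u
  = (\prod_k ((hi k - lo k) / (n k)%:R))
    * dot_energy R _ (laplacian lo hi n) eps u.
Proof.
rewrite /energy !inner_dot /dot_energy mulrDr mulrCA; congr (_ + _ * _).
by apply: eq_bigr => x _; rewrite !mxE mulr1.
Qed.

Lemma ler_mx_norm (R : realType) (m : nat) (v : 'cV[R]_m) x :
  `|v x 0| <= mx_norm v.
Proof. by rewrite mx_normrE; apply/bigmax_geP; right => /=; exists (x, 0). Qed.

Theorem theorem4p4 (R : realType) (d : nat) (lo hi : 'I_d -> R)
    (n : 'I_d -> nat) (eps kappa tau : R) (s p : nat) (a : nat -> nat -> R)
    (u : nat -> gridfun R n) (U : nat -> nat -> gridfun R n) :
  (1 <= d <= 3)%N ->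
  (forall k, lo k < hi k) ->
  (forall k, (0 < n k)%N /\ ~~ odd (n k)) ->
  0 < eps -> 0 <= kappa -> 0 < tau ->
  efrk_coeffs s p a ->
  let L := stiff lo hi n eps kappa in
  (forall i, (1 <= i <= s)%N -> phimx a tau L i \in unitmx) ->
  (forall i, (1 <= i <= s)%N -> a i i.-1 != 0) ->
  meanzero lo hi (u 0%N) ->
  efrk_trajectory lo hi eps kappa tau s a u U ->
  let stage_norms := [set x | exists t i, (i <= s)%N /\ x = mx_norm (U t i)] in
  has_ubound stage_norms ->
  (forall xi : R, `|xi| <= sup stage_norms ->
     2^-1 * `|(@nonlin R)^`()%classic xi| <= kappa) ->
  (forall i j, (1 <= j)%N -> (j < i)%N -> (i <= s)%N ->
     psd_meanzero lo hi (Delta a tau L i j)) ->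
  (forall i, (1 <= i <= s)%N ->
     psd_meanzero lo hi
       (Delta a tau L i i
        - 2^-1 *: \sum_(1 <= j < i) Delta a tau L i j
        - 2^-1 *: \sum_(i.+1 <= j < s.+1) Delta a tau L j i)) ->
  forall t, energy lo hi eps (u t.+1) <= energy lo hi eps (u t).
Proof.
move=> _ lohi npar _ _ tau0 [_ _ eqp] L Pu a0 _ traj norms ubn kge poff pdiag t.
have n0 k : (0 < n k)%N := proj1 (npar k).
have h0 : 0 < \prod_k ((hi k - lo k) / (n k)%:R).
  by apply: prodr_gt0 => k _; rewrite divr_gt0 ?subr_gt0 ?ltr0n.
have [U0 stage uS] := traj t.
rewrite !energyE ler_pM2l// uS -U0.
(* The cell volume is positive and drops out of both the mean-zero condition and the sign. *)
have psd0P (M : 'M[R]_#|gridpt n|) : psd_meanzero lo hi M -> psd0 R _ M.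
  move=> pM v v0; have := pM v; rewrite /meanzero !inner_dot pmulr_rge0//.
  by apply; rewrite dotC v0 mulr0.
have norm_le i x : (i <= s)%N -> `|U t i x 0| <= sup norms.
  move=> lis; apply: (le_trans (ler_mx_norm _ _ _ _)).
  by apply: ub_le_sup => //; exists t, i.
have sup_ge0 : 0 <= sup norms.
  apply: le_trans (ub_le_sup ubn _); last by exists t, 0%N.
  by rewrite mx_normrE; apply/bigmax_geP; left.
(* The assumption on kappa is taken at xi = beta, where f'(beta) = 3 beta^2 - 1 is at most its
   absolute value. *)
have kappa_ge : 2^-1 * (3 * sup norms ^+ 2 - 1) <= kappa.
  have := kge (sup norms); rewrite ger0_norm// lexx derive1_nonlin => /(_ isT).
  by apply: le_trans; rewrite ler_wpM2l ?invr_ge0// ler_norm.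
apply: (dot_energy_decay R _ _ (gridgrad R d lo hi n) (laplacian lo hi n)
  _ _ _ _ _ eps kappa (sup norms) tau s a (U t)) => //.
- exact: gridgrad_sym.
- exact: gridgrad_one.
- exact: gridgrad_comm.
- exact: gridgrad_ker.
- exact: laplacian_gridgrad.
- by move=> i is_; rewrite stage// mulKVmx ?Pu// U0.
- by move=> i j j1 ji lis; apply/psd0P/poff.
- by move=> i is_; apply/psd0P/pdiag.
Qed.
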